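(* Let $q$ be a prime power, and let $g(x)=a_1x^2+b_1x+c_1$ and $h(x)=a_2x^2+b_2x+c_2$ in $\mathbb{F}_q[x]$ be relatively prime polynomials with $\max(\deg(g),\deg(h))=2$. Let $n>1$ be an integer and let $I_{(n,g,h)}$ be the set of monic irreducible polynomials $f(x)$ of degree $n$ over $\mathbb{F}_q$ whose quadratic transformation by $g$ and $h$, i.e. the polynomial $p(x)=h(x)^n f\left(\frac{g(x)}{h(x)}\right)$, is irreducible over $\mathbb{F}_q$. Then \[ \#I_{(n,g,h)} = \begin{cases} 0, & \text{if } b_1=b_2=0 \text{ and } q=2^l \text{ for some integer } l\ge 1,\\[4pt] \dfrac{1}{2n}(q^n-1), & \text{if } q \text{ is odd and } n=2^m \text{ for some integer } m\ge 1,\\[8pt] \dfrac{1}{2n}\displaystyle\sum_{\substack{d\mid n\\ d\ \mathrm{odd}}}\mu(d)\,q^{n/d}, & \text{otherwise.} \end{cases} \]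
   Context: $\mathbb{F}_q$ denotes the finite field with $q$ elements. The coefficients $a_i,b_i,c_i$ lie in $\mathbb{F}_q$; either of $a_1,a_2$ may be zero, but not both, since $\max(\deg(g),\deg(h))=2$. For $f(x)=\sum_{i=0}^n f_i x^i$, the expression $h(x)^n f(g(x)/h(x))$ means the polynomial $\sum_{i=0}^n f_i\, g(x)^i h(x)^{n-i}\in\mathbb{F}_q[x]$. The sum in the third case runs over the positive odd divisors $d$ of $n$, and $\mu$ is the Möbius function. *)

(* Defs.v *)
From HB Require Import structures.
From mathcomp Require Import all_boot all_order all_algebra all_field.

Set Implicit Arguments.
Unset Strict Implicit.
Unset Printing Implicit Defensive.

Import GRing.Theory.
Local Open Scope ring_scope.

(* The Moebius function; only its values at n > 0 are meaningful. *)
Definition mobius (n : nat) : int :=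
  if all (fun p => ~~ (p ^ 2 %| n)%N) (primes n)
  then (-1) ^+ size (primes n) else 0.

(* h(x)^n f(g(x)/h(x)) with denominators cleared; n is meant to be deg f. *)
Definition quad_transform (R : nzRingType) (n : nat) (g h f : {poly R}) :
    {poly R} :=
  \sum_(i < n.+1) f`_i *: (g ^+ i * h ^+ (n - i)).

(* {poly_(n.+1) F} is the finite type of polynomials of degree at most n. *)
Definition I_set (F : finFieldType) (n : nat) (g h : {poly F}) :
    {set {poly_(n.+1) F}} :=
  [set f : {poly_(n.+1) F} |
    [&& size (f : {poly F}) == n.+1,
        (f : {poly F}) \is monic,
        irreducibleb (f : {poly F})
      & irreducibleb (quad_transform n g h f)]].

(* Main.v *)
(* Let u, v, w be the 2x2 minors of the coefficients of g and h. The polynomial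
   B(x,y) = u xy + v(x+y) + w equals (g(x)h(y) - g(y)h(x))/(x - y), so for
   x <> y it vanishes iff x and y have the same image under g/h; coprimality
   of g and h says v^2 <> uw. Write F for the field with q elements. The roots
   in its algebraic closure of the transforms of the members of I are exactly
   the x of degree 2n over F with B(x, x^(q^n)) = 0, so 2n #I is the number of
   such x. In the first case u = w = 0, so B(x, y) = 0 forces y = -x = x, and
   there is none.

   Put Q = q^m. The polynomial B(X, X^Q) is separable, of degree Q + [u <> 0],
   and its roots satisfy x^(Q^2) = x. Removing the roots fixed by x |-> x^Q,
   which are roots of B(X, X), leaves q^m + eps of them, where eps depends only
   on the parity of m. For odd d | n the set obtained for m = n/d consists of
   the members of the set for m = n that are fixed by x |-> x^(q^(2n/d)), and
   Moebius summation over d isolates the members of degree exactly 2n. The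
   total contribution of eps is eps if n is a power of 2, and 0 otherwise. *)
Require Import Defs.
From HB Require Import structures.
From mathcomp Require Import all_boot all_order all_algebra all_field.
From mathcomp Require Import ring zify.

Set Implicit Arguments.
Unset Strict Implicit.
Unset Printing Implicit Defensive.

Import GRing.Theory Num.Theory.
Local Open Scope ring_scope.

(** * The Frobenius orbit of an algebraic element *)

(* The embedding e only witnesses that #|F| is a power of the characteristic of
   K, so that x |-> x ^+ (#|F| ^ m) is a ring morphism. *)
Definition frob (F : finFieldType) (K : fieldType) (e : {rmorphism F -> K})
  (m : nat) (x : K) : K := x ^+ (#|F| ^ m).

Section Frobenius.

Variables (F : finFieldType) (K : fieldType) (phi : {rmorphism F -> K}).
Implicit Types (x y : K) (f : {poly F}) (d k m : nat).

Local Notation fr := (frob phi).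
Local Notation "f ^i" := (map_poly phi f) (at level 2, format "f ^i").

Lemma pnat_card m : [pchar K].-nat (#|F| ^ m)%N.
Proof.
have [p p_pr pF] := finPcharP F.
have pK : p \in [pchar K] by rewrite (fmorph_pchar phi).
by rewrite pnatX (eq_pnat _ (pcharf_eq pK)) (card_pprimeChar pF) pnatX pnat_id.
Qed.

Fact frob_zmod_morphism m : zmod_morphism (fr m).
Proof.
move=> x y; rewrite /frob exprDn_pchar ?pnat_card // -mulN1r exprMn.
have := pnat_card m; set Q := (_ ^ m)%N => pQ.
(* No case split on the parity of [Q]: additivity of the [Q]-th power gives (-1)^Q + 1^Q = 0^Q =
   0. *)
suff -> : (-1) ^+ Q = -1 :> K by rewrite mulN1r.
have Q0 : (0 < Q)%N by rewrite expn_gt0 (ltnW (finRing_gt1 F)).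
by apply/eqP; rewrite -subr_eq0 opprK -[X in _ + X](expr1n _ Q)
  -exprDn_pchar // addNr expr0n -(prednK Q0).
Qed.

Fact frob_monoid_morphism m : monoid_morphism (fr m).
Proof. by split=> [|x y]; rewrite /frob ?expr1n ?exprMn. Qed.

HB.instance Definition _ m :=
  GRing.isZmodMorphism.Build K K (fr m) (frob_zmod_morphism m).
HB.instance Definition _ m :=
  GRing.isMonoidMorphism.Build K K (fr m) (frob_monoid_morphism m).

Lemma frob0 x : fr 0 x = x. Proof. by rewrite /frob expn0 expr1. Qed.

Lemma frob_comp k m x : fr k (fr m x) = fr (k + m) x.
Proof. by rewrite /frob -exprM -expnD addnC. Qed.

Lemma frob_embed m a : fr m (phi a) = phi a.
Proof.
rewrite /frob -rmorphXn; congr (phi _).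
by elim: m => [|m IH]; rewrite ?expn0 ?expr1 // expnSr exprM IH expf_card.
Qed.

Lemma frob_map m f : map_poly (fr m) f^i = f^i.
Proof. by rewrite -map_poly_comp; apply: eq_map_poly => a /=; rewrite frob_embed. Qed.

Lemma horner_frob m f x : fr m f^i.[x] = f^i.[fr m x].
Proof. by rewrite -horner_map frob_map. Qed.

Lemma root_frob m f x : root f^i x -> root f^i (fr m x).
Proof. by rewrite /root -horner_frob => /eqP ->; rewrite rmorph0. Qed.

(** With q = #|F|, X^q - X is the product of all X - a with a in [F], and [x] is one of its
    roots. *)
Lemma frob_fixed x : fr 1 x = x -> exists a, x = phi a.
Proof.
rewrite /frob expn1 => xq.
have : root ('X^#|F| - 'X : {poly F})^i x.
  by rewrite rmorphB /= map_polyXn map_polyX /root !hornerE xq subrr.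
rewrite finField_genPoly rmorph_prod /root horner_prod prodf_seq_eq0.
move=> /hasP[a _] /=; rewrite map_polyXsubC hornerXsubC subr_eq0 => /eqP ->.
by exists a.
Qed.

Lemma frob_mul k d x : fr d x = x -> fr (k * d) x = x.
Proof. by move=> xd; elim: k => [|k IH]; rewrite ?frob0 // mulSn -frob_comp IH. Qed.

(* x has degree exactly d over F, read off from its Frobenius orbit. *)
Definition fdeg d x :=
  [&& (0 < d)%N, fr d x == x & [forall k : 'I_d, (0 < k)%N ==> (fr k x != x)]].

Lemma fdeg_gt0 d x : fdeg d x -> (0 < d)%N. Proof. by case/and3P. Qed.

Lemma fdegE d x k : fdeg d x -> (fr k x == x) = (d %| k)%N.
Proof.
case/and3P=> d0 /eqP xd /forallP xk.
rewrite {1}(divn_eq k d) addnC -frob_comp frob_mul //.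
have := xk (Ordinal (ltn_pmod k d0)); rewrite /= /dvdn lt0n.
by case: eqP => [->|_] //=; [rewrite frob0 eqxx | move/negbTE].
Qed.

Lemma fdeg_exists e x : (0 < e)%N -> fr e x = x ->
  exists2 d, (d <= e)%N & fdeg d x.
Proof.
move=> e0 xe.
have ex : exists d, (0 < d)%N && (fr d x == x) by exists e; rewrite e0 xe /=.
case: (ex_minnP ex) => d /andP[d0 xd] dmin; exists d.
  by apply: dmin; rewrite e0 xe /=.
rewrite /fdeg d0 xd; apply/forallP => k; apply/implyP => k0.
by apply/negP => xk; have := dmin k; rewrite k0 xk leqNgt ltn_ord => /(_ isT).
Qed.

Lemma frob_sub k l x : (k <= l)%N -> fr k x = fr l x -> fr (l - k) x = x.
Proof. by move=> kl E; apply: (fmorph_inj (fr k)); rewrite /= frob_comp subnKC. Qed.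

Lemma fdeg_frob_eq d x k l : fdeg d x -> (k < d)%N -> (l < d)%N ->
  fr k x = fr l x -> k = l.
Proof.
wlog kl : k l / (k <= l)%N => [W|xd _ ld kl_eq].
  by case: (leqP k l) => [/W //|/ltnW /W kl xd kd ld /esym/kl->].
apply/eqP; rewrite eqn_leq kl /= -subn_eq0.
have /eqP := frob_sub kl kl_eq; rewrite (fdegE _ xd).
case: (posnP (l - k)%N) => [->//|p0] /(dvdn_leq p0); rewrite leqNgt.
by rewrite (leq_ltn_trans (leq_subr _ _)).
Qed.

(** * Conjugates and minimal polynomials *)

Definition fconj d x := mkseq (fr^~ x) d.

Lemma fconj_uniq d x : fdeg d x -> uniq (fconj d x).
Proof.
move=> xd; rewrite map_inj_in_uniq ?iota_uniq // => k l.
by rewrite !mem_iota /= !add0n => kd ld; apply: (fdeg_frob_eq xd).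
Qed.

(** Frobenius permutes the conjugates, so it fixes every coefficient of their product, and
    [frob_fixed] puts these coefficients in [F]. *)
Lemma minpoly_exists d x : fdeg d x ->
  exists f, f^i = \prod_(z <- fconj d x) ('X - z%:P).
Proof.
case: d => [/fdeg_gt0 //|d xd]; set P := \prod_(z <- _) _.
have frP : map_poly (fr 1) P = P.
  rewrite /P rmorph_prod (eq_bigr (fun z => 'X - (fr 1 z)%:P)) /=; last first.
    by move=> z _; rewrite map_polyXsubC.
  rewrite -(big_map (fr 1) xpredT (fun z => 'X - z%:P)).
  apply: perm_big; rewrite perm_sym.
  have Uc := fconj_uniq xd.
  have Um : uniq (map (fr 1) (fconj d.+1 x)).
    by rewrite map_inj_uniq //; apply: fmorph_inj.
  apply: uniq_perm => // z.
  suff sub : {subset map (fr 1) (fconj d.+1 x) <= fconj d.+1 x}.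
    by have [|_ ->] := uniq_min_size Um sub; rewrite ?size_map.
  move=> _ /mapP[_ /mapP[k kd ->] ->]; rewrite frob_comp add1n.
  move: kd; rewrite mem_iota /= add0n ltnS leq_eqVlt => /orP[/eqP ->|kd].
    have /and3P[_ /eqP -> _] := xd.
    by apply/mapP; exists 0; rewrite ?frob0 // mem_iota.
  by apply/mapP; exists k.+1; rewrite // mem_iota.
(* Stated with [==] so that [xchoose] can pick the preimages. *)
have lift i : exists a, P`_i == phi a.
  have [|a ->] := @frob_fixed P`_i; last by exists a.
  by rewrite -[in RHS]frP coef_map.
exists (\poly_(i < size P) xchoose (lift i)).
apply/polyP => i; rewrite coef_map coef_poly /=.
case: ltnP => [_|Pi]; first by rewrite -(eqP (xchooseP (lift i))).
by rewrite rmorph0 nth_default.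
Qed.

Definition is_minpoly d x f := f^i == \prod_(z <- fconj d x) ('X - z%:P).

Lemma size_minpoly d x f : is_minpoly d x f -> size f = d.+1.
Proof.
by move/eqP=> E; rewrite -(size_map_poly phi f) E size_prod_XsubC size_mkseq.
Qed.

Lemma monic_minpoly d x f : is_minpoly d x f -> f \is monic.
Proof.
by move/eqP=> E; rewrite -(map_monic phi) E monic_prod_XsubC.
Qed.

Lemma root_minpoly d x f y : is_minpoly d x f -> root f^i y = (y \in fconj d x).
Proof. by move/eqP->; rewrite root_prod_XsubC. Qed.

Lemma dvdp_minpoly d x f f1 : fdeg d x -> is_minpoly d x f ->
  root f1^i x -> f %| f1.
Proof.
move=> xd /eqP E rx; rewrite -(dvdp_map phi) E.
apply: uniq_roots_dvdp; last by rewrite uniq_rootsE fconj_uniq.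
by apply/allP => _ /mapP[k _ ->]; apply: root_frob.
Qed.

Lemma minpoly_eqp d x f f1 : fdeg d x -> is_minpoly d x f ->
  root f1^i x -> f1 != 0 -> (size f1 <= d.+1)%N -> f %= f1.
Proof.
move=> xd mf rx f10 sf1; have dv := dvdp_minpoly xd mf rx.
by rewrite -dvdp_size_eqp // eqn_leq dvdp_leq // (size_minpoly mf).
Qed.

Lemma self_fconj d x : fdeg d x -> x \in fconj d x.
Proof.
move=> /fdeg_gt0 d0; apply/mapP; exists 0%N; rewrite ?frob0 //.
by rewrite mem_iota.
Qed.

(** Up to a unit, [f] is the minimal polynomial of [x]. In a factorization, the factor vanishing at
    [x] already has full size, so the other one is constant. *)
Lemma fdeg_irreducible d x f : fdeg d x -> root f^i x -> f != 0 ->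
  (size f <= d.+1)%N -> irreducible_poly f.
Proof.
move=> xd rx f0 sf; have [m /eqP mm] := minpoly_exists xd.
have eqm := minpoly_eqp xd mm rx f0 sf.
have sfE : size f = d.+1 by rewrite -(eqp_size eqm) (size_minpoly mm).
split; first by rewrite sfE ltnS (fdeg_gt0 xd).
move=> f1 sf1 /dvdpP[f2 Ef].
have [f10 f20] : f1 != 0 /\ f2 != 0.
  by split; apply: contraNneq f0 => z; rewrite Ef z ?mulr0 ?mul0r.
have s12 : (size f2 + size f1 = d.+2)%N.
  have := sfE; rewrite Ef size_mul // => /= s; rewrite -s prednK //.
  by rewrite addn_gt0 lt0n size_poly_eq0 f20.
have size_root f3 : f3 != 0 -> root f3^i x -> (d.+1 <= size f3)%N.
  by move=> f30 r3; rewrite -(size_minpoly mm) dvdp_leq // (dvdp_minpoly xd mm).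
have := rx; rewrite Ef rmorphM rootM => /orP[/(size_root _ f20)|/(size_root _ f10)] sd.
  have : (size f1 <= 1)%N by rewrite -(leq_add2l d.+1) addn1 -s12 leq_add2r.
  by move: sf1 f10; rewrite -size_poly_eq0; case: (size f1) => [|[]].
rewrite -dvdp_size_eqp ?Ef ?dvdp_mull // -Ef sfE eqn_leq sd andbT.
by rewrite -sfE dvdp_leq // Ef dvdp_mull.
Qed.

(** If a positive iterate of index at most deg f fixes [x], the minimal polynomial of [x] divides
    [f], and irreducibility forces equal degrees. Otherwise [x] has more than deg f distinct
    conjugates, all roots of [f]. *)
Lemma irreducible_fdeg f x : irreducible_poly f -> root f^i x ->
  fdeg (size f).-1 x.
Proof.
move=> [sf irr] rx; have f0 : f != 0 by rewrite -size_poly_gt0 ltnW.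
set d := (size f).-1; have sfE : size f = d.+1 by rewrite prednK // ltnW.
have [/existsP[e /andP[e0 /eqP xe]]|noe] :=
    boolP [exists e : 'I_d.+1, (0 < e)%N && (fr e x == x)].
  have [k ke xk] := fdeg_exists e0 xe; have [m /eqP mm] := minpoly_exists xk.
  have dv := dvdp_minpoly xk mm rx; have sm := size_minpoly mm.
  have /irr /(_ dv) /eqp_size : size m != 1%N.
    by rewrite sm eqSS -lt0n (fdeg_gt0 xk).
  by rewrite sm sfE => -[<-].
have U : uniq (fconj d.+1 x).
  rewrite map_inj_in_uniq ?iota_uniq // => k l.
  rewrite !mem_iota /= !add0n.
  wlog kl : k l / (k <= l)%N => [W|kd ld kl_eq].
    by case: (leqP k l) => [/W //|/ltnW /W W' kd ld /esym E]; rewrite W'.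
  apply: contraNeq noe => nkl; apply/existsP.
  have lt : (l - k < d.+1)%N by rewrite (leq_ltn_trans (leq_subr _ _)).
  by exists (Ordinal lt); rewrite /= (frob_sub kl kl_eq) eqxx andbT subn_gt0 ltn_neqAle nkl.
suff : (size (fconj d.+1 x) < size f^i)%N by rewrite size_map_poly sfE size_mkseq ltnn.
apply: max_poly_roots; rewrite ?map_poly_eq0 //.
by apply/allP => _ /mapP[k _ ->]; apply: root_frob.
Qed.

End Frobenius.
(** * Sums of the Moebius function *)

Lemma mobius_primeM p d : prime p -> (0 < d)%N -> ~~ (p %| d)%N ->
  mobius (p * d) = - mobius d.
Proof.
move=> pp d0 pd; have p0 := prime_gt0 pp.
have pr : perm_eq (primes (p * d)) (p :: primes d).
  apply: uniq_perm; first exact: primes_uniq.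
    by rewrite /= primes_uniq mem_primes pp d0 (negbTE pd).
  by move=> r; rewrite primesM // primes_prime // !inE.
rewrite /mobius (perm_size pr) (perm_all _ pr) /=.
have -> : ~~ (p ^ 2 %| p * d)%N by rewrite expnS expn1 dvdn_pmul2l.
have -> : all (fun r => ~~ (r ^ 2 %| p * d)%N) (primes d)
        = all (fun r => ~~ (r ^ 2 %| d)%N) (primes d).
  apply: eq_in_all => r; rewrite mem_primes => /and3P[rp _ rd].
  rewrite Gauss_dvdr // coprimeXl // prime_coprime // dvdn_prime2 //.
  by apply: contraNneq pd => <-.
by case: (all _ _); rewrite /= ?oppr0 ?exprS ?mulN1r.
Qed.

Lemma mobius_primeM_dvd p d : prime p -> (0 < d)%N -> (p %| d)%N ->
  mobius (p * d) = 0.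
Proof.
move=> pp d0 pd; rewrite /mobius; case: allP => // /(_ p).
rewrite mem_primes pp muln_gt0 (prime_gt0 pp) d0 dvdn_mulr //= => /(_ isT).
by rewrite expnS expn1 dvdn_mul.
Qed.

(** For a prime [p] dividing [e], a divisor [d] prime to [p] cancels against [p * d], and the
    multiples of p^2 contribute 0. *)
Lemma sum_mobius e : (0 < e)%N ->
  \sum_(d <- divisors e) mobius d = (e == 1%N)%:R.
Proof.
move=> e0; case: eqVneq => [->|e1]; first by rewrite big_seq1.
pose p := pdiv e.
have pp : prime p by rewrite pdiv_prime // ltn_neqAle eq_sym e1.
have p0 := prime_gt0 pp.
have Ee : e = (p * (e %/ p))%N by rewrite mulnC divnK ?pdiv_dvd.
set e' := (e %/ p)%N in Ee.
have e'0 : (0 < e')%N by move: e0; rewrite Ee muln_gt0 => /andP[].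
rewrite (bigID (fun d => p %| d)%N) /= -big_filter.
rewrite (perm_big (map (muln p) (divisors e'))) /=; last first.
  apply: uniq_perm; first by rewrite filter_uniq ?divisors_uniq.
    rewrite map_inj_uniq ?divisors_uniq // => x y /eqP.
    by rewrite eqn_pmul2l // => /eqP.
  move=> d; rewrite mem_filter -dvdn_divisors //.
  apply/andP/mapP => [[/dvdnP[k ->]]|[k]].
    by rewrite mulnC Ee dvdn_pmul2l // => kd; exists k; rewrite // -dvdn_divisors.
  by rewrite -dvdn_divisors // => kd ->; rewrite Ee dvdn_pmul2l // dvdn_mulr.
rewrite big_map (bigID (fun d => p %| d)%N) /= big_seq_cond big1 ?add0r; last first.
  move=> d /andP[]; rewrite -dvdn_divisors // => de pd.
  by rewrite mobius_primeM_dvd // (dvdn_gt0 e'0).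
rewrite -[X in _ + X](big_filter (divisors e)).
rewrite [X in _ + X](perm_big (filter (fun d => ~~ (p %| d)%N) (divisors e'))).
  rewrite /= big_filter. rewrite -big_split /= big_seq_cond big1 // => d /andP[].
  rewrite -dvdn_divisors // => de pd.
  by rewrite mobius_primeM // ?(dvdn_gt0 e'0) // addNr.
apply: uniq_perm; rewrite ?filter_uniq ?divisors_uniq // => d.
rewrite !mem_filter -!dvdn_divisors //; case: (boolP (p %| d)%N) => //= pd.
by rewrite Ee Gauss_dvdr // coprime_sym prime_coprime.
Qed.

(** The odd divisors of [n] are the divisors of its odd part, which is 1 exactly when [n] is a power
    of 2. *)
Lemma sum_mobius_odd n : (0 < n)%N ->
  \sum_(d <- divisors n | odd d) mobius d = (n == 2 ^ logn 2 n)%N%:R.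
Proof.
move=> n0; rewrite -big_filter (perm_big (divisors (n`_2^')%N)) /=; last first.
  apply: uniq_perm; rewrite ?filter_uniq ?divisors_uniq // => d.
  rewrite mem_filter -!dvdn_divisors //.
  apply/andP/idP => [[od dn]|dn].
    have := partn_dvd (2^')%N n0 dn; rewrite part_pnat_id //.
    by rewrite -odd_2'nat.
  split; last exact: dvdn_trans dn (dvdn_part _ _).
  by apply: dvdn_odd dn _; rewrite odd_2'nat part_pnat.
rewrite sum_mobius ?part_gt0 // -p_part; congr (nat_of_bool _)%:R.
rewrite -[X in _ = (X == _)](partnC 2%N n0) -[X in _ = (_ == X)]muln1.
by rewrite eqn_pmul2l ?part_gt0.
Qed.

(** Write 2n = eD. As [D] does not divide [n], [e] is odd, and the odd [d] that count are the
    divisors of [e]; [sum_mobius] gives [e = 1]. This inversion isolates the points of degree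
    exactly 2n. *)
Lemma sum_mobius_odd_dvd n D : (0 < n)%N -> (D %| 2 * n)%N -> ~~ (D %| n)%N ->
  \sum_(d <- divisors n | odd d) mobius d * (D %| 2 * (n %/ d))%N%:R
  = (D == 2 * n)%N%:R.
Proof.
move=> n0 /dvdnP[e Ee] Dn.
have [e0 D0] : (0 < e)%N /\ (0 < D)%N.
  by apply/andP; rewrite -muln_gt0 -Ee muln_gt0.
have oe : odd e.
  apply: contraR Dn => ev; move: Ee; rewrite -[e]odd_double_half (negbTE ev) add0n.
  rewrite -mul2n -mulnA => /eqP; rewrite eqn_pmul2l // => /eqP ->.
  by rewrite dvdn_mull.
rewrite (bigID (fun d => D %| 2 * (n %/ d))%N) /= [X in _ + X]big1 ?addr0; last first.
  by move=> d /andP[_ /negbTE ->]; rewrite mulr0.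
rewrite (eq_bigr mobius) => [|d /andP[_ ->]]; last by rewrite mulr1.
rewrite -big_filter (perm_big (divisors e)) /=.
  rewrite sum_mobius // Ee; congr (nat_of_bool _)%:R.
  by rewrite -[X in _ = (X == _)]mul1n eqn_pmul2r // eq_sym.
apply: uniq_perm; rewrite ?filter_uniq ?divisors_uniq // => d.
rewrite mem_filter -!dvdn_divisors //; apply/idP/idP => [/andP[/andP[od Dd] dn]|de].
  have d0 := dvdn_gt0 n0 dn.
  move: Dd; rewrite -(dvdn_pmul2r d0) -mulnA divnK // Ee mulnC dvdn_pmul2r //.
have od := dvdn_odd de oe.
have dn : (d %| n)%N.
  rewrite -(@Gauss_dvdr d 2) ?Ee ?dvdn_mulr //.
  by rewrite coprime_sym prime_coprime // dvdn2 negbK.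
have d0 := dvdn_gt0 n0 dn.
by rewrite od dn -(dvdn_pmul2r d0) -mulnA divnK // Ee mulnC dvdn_pmul2r // de.
Qed.

(** * Quadratic transformations *)

Lemma separable_roots (K : closedFieldType) (p : {poly K}) :
  p != 0 -> separable_poly p ->
  exists Z : seq K, [/\ uniq Z, size Z = (size p).-1 & forall x, (x \in Z) = root p x].
Proof.
move=> p0; have [Z Ep] := closed_field_poly_normal p.
have lp : lead_coef p != 0 by rewrite lead_coef_eq0.
move=> sepp; exists Z; split.
- move: sepp; rewrite Ep -mul_polyC separable_mul separable_prod_XsubC.
  by case/and3P.
- by rewrite Ep size_scale // size_prod_XsubC.
- by move=> x; rewrite Ep rootZ // root_prod_XsubC.
Qed.

Lemma separable_Bezout (L : fieldType) (p s t : {poly L}) c : c != 0 ->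
  s * p + t * p^`() = c%:P -> separable_poly p.
Proof.
move=> c0 E; rewrite separable_poly.unlock; apply/Bezout_coprimepP.
by exists (s, t); rewrite /= E -alg_polyC eqp_scale.
Qed.

Lemma natr_count (R : nzRingType) (T : Type) (P : pred T) (s : seq T) :
  (count P s)%:R = \sum_(x <- s) (P x)%:R :> R.
Proof. by elim: s => [|x s IH]; rewrite ?big_nil // big_cons /= natrD IH. Qed.

(** * Top coefficients of products under degree bounds *)

Section TopCoefficient.

Variable R : nzRingType.
Implicit Types A B : {poly R}.

(** Bounds replace exact sizes because one of [g], [h] may have degree below 2, while the
    coefficient of X^(2n) in the transform is still wanted. *)
Lemma coefM_top A B a b : (size A <= a.+1)%N -> (size B <= b.+1)%N ->
  (A * B)`_(a + b) = A`_a * B`_b.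
Proof.
move=> sA sB; rewrite coefM.
have la : (a < (a + b).+1)%N by rewrite ltnS leq_addr.
rewrite (bigD1 (Ordinal la)) //= addKn big1 ?addr0 // => j; rewrite -val_eqE /=.
case: ltngtP => // [ja|aj] _.
  rewrite [X in _ * X]nth_default ?mulr0 //; apply: leq_trans sB _.
  by rewrite ltn_subRL ltn_add2r.
by rewrite nth_default ?mul0r //; apply: leq_trans sA _.
Qed.

Lemma size_mul_top A B a b : (size A <= a.+1)%N -> (size B <= b.+1)%N ->
  (size (A * B)%R <= (a + b).+1)%N.
Proof.
move=> sA sB; apply: leq_trans (size_polyMleq _ _) _.
by case: (size A + size B)%N (leq_add sA sB) => [|s] //; rewrite addSn addnS.
Qed.

Lemma exp_top A a i : (size A <= a.+1)%N ->
  (size (A ^+ i)%R <= (a * i).+1)%N /\ (A ^+ i)`_(a * i) = A`_a ^+ i.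
Proof.
move=> sA; elim: i => [|i [IHs IHc]]; first by rewrite muln0 !expr0 size_poly1 coef1.
by rewrite mulnS !exprS; split; [apply: size_mul_top | rewrite coefM_top ?IHc].
Qed.

End TopCoefficient.

(** The sum is the homogenization of [f] at the point (s : t). At t = 0 only the leading term
    survives, so infinity is never a zero. *)
Lemma homog_eval_eq0 (L : fieldType) (f : {poly L}) n s t :
  size f = n.+1 -> (s != 0) || (t != 0) ->
  (\sum_(i < n.+1) f`_i * (s ^+ i * t ^+ (n - i)) == 0)
  = (t != 0) && root f (s / t).
Proof.
move=> sf st; have fn : f`_n != 0.
  by rewrite -[n]/(n.+1.-1) -sf lead_coef_eq0 -size_poly_eq0 sf.
have [t0|t0] /= := eqVneq t 0.
  rewrite big_ord_recr /= subnn expr0 mulr1 big1 ?add0r => [|i _]; last first.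
    by rewrite t0 expr0n subn_eq0 leqNgt ltn_ord !mulr0.
  move: st; rewrite t0 eqxx orbF => s0.
  by rewrite mulf_eq0 (negbTE fn) expf_eq0 (negbTE s0) andbF.
rewrite [X in X == 0](_ : _ = t ^+ n * f.[s / t]).
  by rewrite mulf_eq0 expf_eq0 (negbTE t0) andbF.
rewrite horner_coef sf mulr_sumr; apply: eq_bigr => i _.
have -> : t ^+ n = t ^+ (n - i) * t ^+ i by rewrite -exprD subnK // -ltnS.
rewrite expr_div_n; have := expf_neq0 i t0.
by move: (t ^+ i) (t ^+ (n - i)) (s ^+ i) => X Y Z X0; field.
Qed.

Lemma irreducible_no_root (L : fieldType) (f : {poly L}) z :
  irreducible_poly f -> (2 < size f)%N -> ~~ root f z.
Proof.
move=> [_ irr] sf; rewrite -dvdp_XsubCl; apply/negP => /irr.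
by rewrite size_XsubC => /(_ isT) /eqp_size E; rewrite -E size_XsubC in sf.
Qed.

(** * The map g/h and its form [B] *)

Section QuadraticMap.

Variables (F : finFieldType) (K : closedFieldType) (phi : {rmorphism F -> K}).
Variables a1 b1 c1 a2 b2 c2 : F.

Implicit Types (f : {poly F}) (x y z : K) (d m n : nat).

Local Notation fr := (frob phi).
Local Notation "f ^i" := (map_poly phi f) (at level 2, format "f ^i").

Let g : {poly F} := a1 *: 'X^2 + b1 *: 'X + c1%:P.
Let h : {poly F} := a2 *: 'X^2 + b2 *: 'X + c2%:P.

Hypothesis hcop : coprimep g h.
Hypothesis ha : (a1 != 0) || (a2 != 0).

Let G (x : K) := phi a1 * x ^+ 2 + phi b1 * x + phi c1.
Let H (x : K) := phi a2 * x ^+ 2 + phi b2 * x + phi c2.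

Let u := a1 * b2 - a2 * b1.
Let v := a1 * c2 - a2 * c1.
Let w := b1 * c2 - b2 * c1.

(* (g(x) h(y) - g(y) h(x)) / (x - y): for x <> y it vanishes exactly when
   x and y have the same image under g / h. *)
Let B (x y : K) := phi u * (x * y) + phi v * (x + y) + phi w.

Lemma horner_quadratic (a b c : F) x :
  (a *: 'X^2 + b *: 'X + c%:P)^i.[x] = phi a * x ^+ 2 + phi b * x + phi c.
Proof.
by rewrite !rmorphD /= !map_polyZ /= map_polyXn map_polyX map_polyC !hornerE.
Qed.

Lemma horner_g x : g^i.[x] = G x.
Proof. exact: horner_quadratic. Qed.

Lemma horner_h x : h^i.[x] = H x.
Proof. exact: horner_quadratic. Qed.

Lemma size_quadratic (a b c : F) :
  (size (a *: 'X^2 + b *: 'X + c%:P)%R <= 3)%N.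
Proof.
apply/leq_sizeP => j; case: j => [|[|[|j]]] // _.
by rewrite !(coefD, coefZ, coefXn, coefX, coefC) /= !mulr0 !addr0.
Qed.

Lemma coef_quadratic (a b c : F) :
  (a *: 'X^2 + b *: 'X + c%:P)`_2 = a.
Proof. by rewrite !(coefD, coefZ, coefXn, coefX, coefC) /= mulr0 mulr1 !addr0. Qed.

Lemma no_common_root x : G x = 0 -> H x != 0.
Proof.
rewrite -horner_g -horner_h => gx.
by apply: (@coprimep_root _ g^i); [rewrite coprimep_map | apply/eqP].
Qed.

Lemma quadratic_root (a b c : F) : a != 0 ->
  exists x : K, phi a * x ^+ 2 + phi b * x + phi c = 0.
Proof.
move=> a0; pose p : {poly F} := a *: 'X^2 + b *: 'X + c%:P.
have sp : size p^i != 1%N.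
  rewrite size_map_poly; apply: contraNneq a0 => s1.
  by rewrite -(coef_quadratic a b c) nth_default // s1.
have [x] := closed_rootP _ sp; rewrite /root => px; exists x; apply/eqP; move: px.
by rewrite horner_quadratic.
Qed.

(** v^2 - uw is the resultant of [g] and [h]. If it vanishes and u <> 0, then -v/u is a common root.
    If u = 0, then v = 0 too, so a2 g = a1 h, and a root of one of degree 2 is common to both. *)
Lemma resultant_neq0 : v ^+ 2 != u * w.
Proof.
apply/eqP => vuw.
have [u0|u0] := eqVneq u 0; last first.
  have pu : phi u != 0 by rewrite fmorph_eq0.
  pose x := - phi v / phi u.
  have Ex : phi u * x + phi v = 0 by rewrite mulrCA mulfV // mulr1 addNr.
  have Ew : phi u * x ^+ 2 - phi w = 0.
    apply: (mulfI pu); rewrite mulr0 mulrBr -rmorphM -vuw rmorphXn /= /x.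
    by field.
  have /no_common_root/negP[] : G x = 0.
    apply: (mulfI pu); rewrite mulr0.
    transitivity (phi a1 * (phi u * x ^+ 2 - phi w) + phi b1 * (phi u * x + phi v)).
      by rewrite /G /u /v /w !(rmorphB, rmorphM); ring.
    by rewrite Ex Ew !mulr0 addr0.
  apply/eqP; apply: (mulfI pu); rewrite mulr0.
  transitivity (phi a2 * (phi u * x ^+ 2 - phi w) + phi b2 * (phi u * x + phi v)).
    by rewrite /H /u /v /w !(rmorphB, rmorphM); ring.
  by rewrite Ex Ew !mulr0 addr0.
have v0 : v = 0 by apply/eqP; rewrite -sqrf_eq0 vuw u0 mul0r.
have E x : phi a2 * G x = phi a1 * H x.
  apply/eqP; rewrite -subr_eq0; apply/eqP; transitivity (- (phi u * x + phi v)).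
    by rewrite /G /H /u /v !(rmorphB, rmorphM); ring.
  by rewrite u0 v0 !rmorph0 mul0r addr0 oppr0.
have [a20|a20] := eqVneq a2 0.
  have a10 : a1 != 0 by move: ha; rewrite a20 eqxx orbF.
  have [x Gx] := quadratic_root b1 c1 a10.
  case/negP: (no_common_root Gx); move: (E x); rewrite a20 rmorph0 mul0r => /esym/eqP.
  by rewrite mulf_eq0 fmorph_eq0 (negbTE a10).
have [x Hx] := quadratic_root b2 c2 a20.
have := E x; rewrite [H x]Hx mulr0 => /eqP; rewrite mulf_eq0 fmorph_eq0 (negbTE a20).
by move=> /eqP /no_common_root; rewrite [H x]Hx eqxx.
Qed.

Lemma B_sym x y : B x y = B y x.
Proof. by rewrite /B; ring. Qed.

Lemma B_cross x y : (x - y) * B x y = G x * H y - G y * H x.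
Proof. by rewrite /B /G /H /u /v /w !(rmorphB, rmorphM); ring. Qed.

Lemma B_eq0 x y : x != y -> (B x y == 0) = (G x * H y == G y * H x).
Proof.
by move=> xy; rewrite -(subr_eq0 (G x * H y)) -B_cross mulf_eq0 subr_eq0 (negbTE xy).
Qed.

(** In [y], B(x, y) is affine with slope ux + v and constant term vx + w; both vanish only if v^2 =
    uw. So [x] has at most one partner. *)
Lemma B_inj x y z : B x y = 0 -> B x z = 0 -> y = z.
Proof.
move=> By Bz.
have E t : B x t = (phi u * x + phi v) * t + (phi v * x + phi w).
  by rewrite /B; ring.
have [s0|s0] := eqVneq (phi u * x + phi v) 0; last first.
  by apply: (mulfI s0); apply: (addIr (phi v * x + phi w)); rewrite -!E By Bz.
have t0 : phi v * x + phi w = 0 by rewrite -By E s0 mul0r add0r.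
case/eqP: resultant_neq0; apply: (fmorph_inj phi); rewrite rmorphXn rmorphM.
apply/eqP; rewrite -subr_eq0; apply/eqP.
transitivity (phi v * (phi u * x + phi v) - phi u * (phi v * x + phi w)).
  by ring.
by rewrite s0 t0 !mulr0 subr0.
Qed.

Lemma B_frob m x y : B x y = 0 -> B (fr m x) (fr m y) = 0.
Proof.
by rewrite /B => /(congr1 (fr m)); rewrite rmorph0 !(rmorphD, rmorphM)  /= !frob_embed.
Qed.

(** Both [x] and [fr (2 * m) x] are partners of [fr m x]: the first by symmetry, the second by
    applying [fr m] to the relation. *)
Lemma B_frob_period m x : B x (fr m x) = 0 -> fr (2 * m) x = x.
Proof.
move=> Bx; apply: (@B_inj (fr m x)); last by rewrite B_sym.
by rewrite mul2n -addnn -frob_comp B_frob.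
Qed.

(** * Roots and degree of the transform *)

Lemma horner_qt n f x : (quad_transform n g h f)^i.[x] =
  \sum_(i < n.+1) phi f`_i * (G x ^+ i * H x ^+ (n - i)).
Proof.
rewrite rmorph_sum horner_sum; apply: eq_bigr => i _.
by rewrite /= map_polyZ rmorphM !rmorphXn hornerZ hornerM !horner_exp horner_g horner_h.
Qed.

(** The transform at [x] is the homogenization of [f] at (G x : H x), whose coordinates do not both
    vanish by coprimality. *)
Lemma root_qt n f x : size f = n.+1 ->
  root (quad_transform n g h f)^i x = (H x != 0) && root f^i (G x / H x).
Proof.
move=> sf; have GH : (G x != 0) || (H x != 0).
  by rewrite -implybE; apply/implyP => /eqP /no_common_root.
rewrite /root horner_qt -(@homog_eval_eq0 _ _ n _ _ _ GH) ?size_map_poly //.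
by under [in RHS]eq_bigr do rewrite coef_map.
Qed.

Lemma size_qt_leq n f : (size (quad_transform n g h f) <= (2 * n).+1)%N.
Proof.
apply: leq_trans (size_sum _ _ _) _; apply/bigmax_leqP => i _.
apply: leq_trans (size_scale_leq _ _) _.
have -> : (2 * n = 2 * i + 2 * (n - i))%N by rewrite -mulnDr subnKC // -ltnS.
by apply: size_mul_top; apply: (exp_top _ (size_quadratic _ _ _)).1.
Qed.

Lemma coef_qt n f : (quad_transform n g h f)`_(2 * n) =
  \sum_(i < n.+1) f`_i * (a1 ^+ i * a2 ^+ (n - i)).
Proof.
rewrite coef_sum; apply: eq_bigr => i _; rewrite coefZ; congr (_ * _).
have -> : (2 * n = 2 * i + 2 * (n - i))%N by rewrite -mulnDr subnKC // -ltnS.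
have [sg cg] := exp_top i (size_quadratic a1 b1 c1).
have [sh ch] := exp_top (n - i) (size_quadratic a2 b2 c2).
by rewrite (coefM_top sg sh) cg ch !coef_quadratic.
Qed.

(** The coefficient of X^(2n) is the homogenization of [f] at (a1 : a2). It is nonzero since an
    irreducible [f] of degree n > 1 has no root in [F]. *)
Lemma size_qt n f : irreducible_poly f -> size f = n.+1 -> (1 < n)%N ->
  size (quad_transform n g h f) = (2 * n).+1.
Proof.
move=> irr sf n1; apply/eqP; rewrite eqn_leq size_qt_leq ltnNge.
apply: contraTN isT => /leq_sizeP /(_ _ (leqnn _)) /eqP.
rewrite coef_qt homog_eval_eq0 // (negbTE (irreducible_no_root _ irr _)) ?andbF //.
by rewrite sf.
Qed.

(** * Members of [I_set] and points of degree 2n *)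

Lemma frob_G m x : fr m (G x) = G (fr m x).
Proof. by rewrite -!horner_g horner_frob. Qed.

Lemma frob_H m x : fr m (H x) = H (fr m x).
Proof. by rewrite -!horner_h horner_frob. Qed.

Lemma frob_value_eq m x : H x != 0 ->
  (fr m (G x / H x) == G x / H x) = (G x * H (fr m x) == G (fr m x) * H x).
Proof.
move=> Hx; have Hm : H (fr m x) != 0 by rewrite -frob_H fmorph_eq0.
by rewrite fmorph_div /= frob_G frob_H eqr_div // eq_sym.
Qed.

Lemma I_setP n (f : {poly_(n.+1) F}) : reflect
  [/\ size (f : {poly F}) = n.+1, (f : {poly F}) \is monic,
      irreducible_poly (f : {poly F}) & irreducible_poly (quad_transform n g h f)]
  (f \in I_set n g h).
Proof.
rewrite inE; apply: (iffP and4P) => [[/eqP ? ? /irreducibleP ? /irreducibleP ?]|[? ? ? ?]].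
  by split.
by split=> //; [apply/eqP | apply/irreducibleP | apply/irreducibleP].
Qed.

(** [x] has degree 2n and its value under g/h has degree [n], so [fr n] moves [x] but not the
    value. *)
Lemma I_set_root n (f : {poly_(n.+1) F}) x : (1 < n)%N -> f \in I_set n g h ->
  root (quad_transform n g h f)^i x -> fdeg phi (2 * n) x /\ B x (fr n x) = 0.
Proof.
move=> n1 /I_setP[sf mf irrf irrp] rx.
have xd : fdeg phi (2 * n) x.
  by have := irreducible_fdeg irrp rx; rewrite (size_qt irrf).
split=> //; move: rx; rewrite root_qt // => /andP[Hx rf].
have ad : fdeg phi n (G x / H x).
  by have := irreducible_fdeg irrf rf; rewrite sf.
have xfx : x != fr n x.
  rewrite eq_sym (fdegE _ xd); apply/negP => /dvdn_leq; lia.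
apply/eqP; rewrite B_eq0 // -frob_value_eq //.
by rewrite (fdegE _ ad).
Qed.

Lemma fdeg_size d x f : fdeg phi d x -> root f^i x -> f != 0 -> (d < size f)%N.
Proof.
move=> xd rx f0; have [m /eqP mm] := minpoly_exists xd.
by rewrite -(size_minpoly mm) dvdp_leq // (dvdp_minpoly xd mm).
Qed.

Lemma h_neq0 : h != 0.
Proof.
apply/negP => /eqP h0; move: hcop ha; rewrite h0 coprimep0 => /eqp_size.
rewrite size_poly1 => sg.
by rewrite -(coef_quadratic a1 b1 c1) -(coef_quadratic a2 b2 c2) -/g -/h h0 coef0
  nth_default ?sg ?eqxx.
Qed.

(** Degree 2n > 2 keeps [x] from being a root of [h]. If [fr k] fixed the value for some 0 < k < n,
    then [fr k x] and [fr n x] would both be partners of [x], hence equal, although the 2n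
    conjugates are distinct. *)
Lemma fdeg_value n x : (1 < n)%N -> fdeg phi (2 * n) x -> B x (fr n x) = 0 ->
  H x != 0 /\ fdeg phi n (G x / H x).
Proof.
move=> n1 xd Bx.
have Hx : H x != 0.
  rewrite -horner_h; apply/negP => rx; have := fdeg_size xd rx h_neq0.
  by move/leq_trans/(_ (size_quadratic a2 b2 c2)); lia.
split=> //.
have neq k : (0 < k < 2 * n)%N -> x != fr k x.
  by move=> kn; rewrite eq_sym (fdegE _ xd); apply/negP => /dvdn_leq; lia.
apply/and3P; split; first by lia.
  by rewrite frob_value_eq // -B_eq0 ?Bx // neq //; lia.
apply/forallP => k; apply/implyP => k0; have kn := ltn_ord k.
rewrite frob_value_eq // -B_eq0; last by rewrite neq //; lia.
apply/eqP => /(B_inj Bx) /(fdeg_frob_eq xd); lia.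
Qed.

(** [f] is the minimal polynomial of the value of [x] under g/h. The second clause makes it the only
    member whose transform vanishes at [x]. *)
Lemma I_set_exists n x : (1 < n)%N -> fdeg phi (2 * n) x -> B x (fr n x) = 0 ->
  exists2 f : {poly_(n.+1) F}, f \in I_set n g h &
    forall f' : {poly_(n.+1) F}, f' \in I_set n g h ->
      root (quad_transform n g h f')^i x = (f' == f).
Proof.
move=> n1 xd Bx; have [Hx ad] := fdeg_value n1 xd Bx.
have [m /eqP mm] := minpoly_exists ad.
have sm := size_minpoly mm; have mon := monic_minpoly mm.
have rm : root m^i (G x / H x) by rewrite (root_minpoly _ mm) self_fconj.
have irrm : irreducible_poly m.
  by apply: (fdeg_irreducible ad) => //; rewrite ?sm // -size_poly_eq0 sm.
have sP : (size m <= n.+1)%N by rewrite sm.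
have Em := npolypK sP.
have rp : root (quad_transform n g h m)^i x by rewrite root_qt // Hx.
have sp := size_qt irrm sm n1.
exists (npolyp n.+1 m).
  apply/I_setP; rewrite Em; split=> //.
  by apply: (fdeg_irreducible xd) => //; rewrite ?sp // -size_poly_eq0 sp.
move=> f /I_setP[sf mf irrf _]; rewrite root_qt // Hx /=.
apply/idP/eqP => [rf|->]; last by rewrite Em.
apply: val_inj; rewrite /= Em; apply/eqP; rewrite -eqp_monic // eqp_sym.
by apply: (minpoly_eqp ad mm rf); rewrite ?sf // -size_poly_eq0 sf.
Qed.

(** Double counting of pairs (point of [S], member whose transform vanishes there): each point has
    one member, and each member has 2n points, the conjugates of a single root. *)
Lemma card_I_set n (S : seq K) : (1 < n)%N -> uniq S ->
  (forall x, (x \in S) = fdeg phi (2 * n) x && (B x (fr n x) == 0)) ->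
  size S = (2 * n * #|I_set n g h|)%N.
Proof.
move=> n1 US memS.
transitivity (\sum_(x <- S) \sum_(f in I_set n g h)
    (root (quad_transform n g h f)^i x : nat))%N.
  rewrite -sum1_size big_seq [RHS]big_seq; apply: eq_bigr => x.
  rewrite memS => /andP[xd /eqP Bx]; have [f fI fE] := I_set_exists n1 xd Bx.
  rewrite (bigD1 f) //= fE // eqxx big1 // => f' /andP[f'I /negbTE nf].
  by rewrite fE // nf.
rewrite exchange_big /= mulnC -sum_nat_const; apply: eq_bigr => f fI.
have [sf mf irrf irrp] := I_setP _ fI.
have sp := size_qt irrf sf n1.
have [x rx] : exists x, root (quad_transform n g h f)^i x.
  by apply/closed_rootP; rewrite size_map_poly sp; lia.
have [xd Bx] := I_set_root n1 fI rx.
have [m /eqP mm] := minpoly_exists xd.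
rewrite -big_mkcond sum1_count -size_filter -(size_mkseq (fr^~ x) (2 * n)).
apply/perm_size/uniq_perm; rewrite ?filter_uniq ?(fconj_uniq xd) // => y.
rewrite mem_filter -/(fconj phi _ x) -(root_minpoly _ mm).
have eqm := minpoly_eqp xd mm rx.
have -> : root m^i y = root (quad_transform n g h f)^i y.
  apply: eqp_root; rewrite eqp_map; apply: eqm; rewrite ?sp //.
  by rewrite -size_poly_eq0 sp.
case: (boolP (root _ y)) => //= ry; rewrite memS.
by have [-> ->] := I_set_root n1 fI ry; rewrite eqxx.
Qed.

(** * Roots of B(X, X^Q) and of B(X, X) *)

Lemma cardX_eq0 m : (0 < m)%N -> (#|F| ^ m)%:R = 0 :> K.
Proof.
move=> m0; have Q1 : (1 < #|F| ^ m)%N.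
  by rewrite -(exp1n m) ltn_exp2r // finRing_gt1.
have pd : pdiv (#|F| ^ m) \in [pchar K].
  by apply: (pnatPpi (pnat_card phi m)); rewrite pi_pdiv.
by apply/eqP; rewrite -(dvdn_pcharf pd) pdiv_dvd.
Qed.

Lemma uv_neq0 : u = 0 -> v != 0.
Proof.
move=> u0; apply: contraNneq resultant_neq0 => ->.
by rewrite u0 mul0r expr0n.
Qed.

Lemma root_cross_poly Q x :
  root (phi u *: 'X^(Q.+1) + phi v *: ('X^Q + 'X) + (phi w)%:P) x =
  (B x (x ^+ Q) == 0).
Proof. by rewrite /root !hornerE /B exprS [x ^+ Q + x]addrC. Qed.

Lemma cross_roots m : (0 < m)%N -> exists Z : seq K,
  [/\ uniq Z, size Z = (#|F| ^ m + (u != 0%R))%N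
   & forall x, (x \in Z) = (B x (fr m x) == 0)].
Proof.
move=> m0; set Q := (#|F| ^ m)%N.
have QK : Q%:R = 0 :> K by apply: cardX_eq0.
have Q1 : (1 < Q)%N by rewrite -(exp1n m) ltn_exp2r // finRing_gt1.
pose p : {poly K} := phi u *: 'X^(Q.+1) + phi v *: ('X^Q + 'X) + (phi w)%:P.
have cp i : p`_i = phi u * (i == Q.+1)%:R + phi v * ((i == Q)%:R + (i == 1)%:R)
    + (if i == 0 then phi w else 0).
  by rewrite !(coefD, coefZ, coefXn, coefX, coefC).
have sp : size p = (Q + (u != 0%R)).+1%N.
  apply/eqP; rewrite eqn_leq; apply/andP; split.
    apply/leq_sizeP => j; rewrite cp.
    have [->|_] /= := eqVneq u 0; rewrite ?addn0 ?addn1 => Qj.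
      have [-> -> ->] : [/\ (j == Q) = false, (j == 1) = false & (j == 0) = false].
        by split; lia.
      by rewrite /= !(rmorph0, mulr0n, mul0r, mulr0, addr0).
    have [-> -> -> ->] : [/\ (j == Q.+1) = false, (j == Q) = false,
        (j == 1) = false & (j == 0) = false] by split; lia.
    by rewrite /= !(mulr0n, mulr0, addr0).
  (* The top coefficient is [v] at degree [Q] if u = 0, and [u] at degree Q + 1 otherwise. *)
  rewrite ltnNge; apply/negP => /leq_sizeP /(_ _ (leqnn _)) /eqP.
  rewrite cp; have [u0|u0] /= := eqVneq u 0; rewrite ?addn0 ?addn1 eqxx.
    have [-> ->] : (Q == 1) = false /\ (Q == 0) = false by split; lia.
    rewrite /= !(u0, rmorph0, mul0r, add0r, mulr0n, addr0) mulr1.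
    by rewrite fmorph_eq0 (negbTE (uv_neq0 u0)).
  have [-> -> ->] : [/\ (Q.+1 == Q) = false, (Q.+1 == 1) = false & (Q.+1 == 0) = false].
    by split; lia.
  by rewrite /= !(mulr0n, mulr0, addr0) mulr1 fmorph_eq0 (negbTE u0).
have p0 : p != 0 by rewrite -size_poly_eq0 sp.
have p' : p^`() = phi u *: 'X^Q + (phi v)%:P.
  rewrite !(derivD, derivZ, derivXn, derivX, derivC) /= addr0.
  rewrite -[_ *+ Q.+1]mulr_natr -[_ *+ Q]mulr_natr mulrS.
  have -> : Q%:R = 0 :> {poly K} by rewrite -polyC_natr QK.
  by rewrite addr0 mulr0 add0r mulr1 alg_polyC.
have sepp : separable_poly p.
  (* Since p' = u X^Q + v, one has u p - (u X + v) p' = u w - v^2. *)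
  apply: (@separable_Bezout _ _ (phi u)%:P (- ((phi u)%:P * 'X + (phi v)%:P))
    (phi (u * w - v ^+ 2))).
    by rewrite fmorph_eq0 subr_eq0 eq_sym resultant_neq0.
  rewrite p' /p -!mul_polyC exprS (rmorphB phi (u * w)) (rmorphXn phi 2 v)
    (rmorphM phi u) polyCB polyCM polyC_exp.
  by ring.
have [Z [UZ sZ memZ]] := separable_roots p0 sepp; exists Z; split=> //.
  by rewrite sZ sp.
by move=> x; rewrite memZ root_cross_poly.
Qed.

(** In characteristic 2, B(x, x) = u x^2 + w. If u <> 0 it has a single double root, which Frobenius
    must fix; if u = 0 it is a nonzero constant. *)
Lemma fixed_roots_char2 : 2 = 0 :> F -> (b1 != 0) || (b2 != 0) ->
  exists R : seq K, [/\ uniq R, size R = (u != 0),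
    forall x, (x \in R) = (B x x == 0) & forall x, x \in R -> fr 1 x = x].
Proof.
move=> two hb; have twoK : 2 = 0 :> K by rewrite -(rmorph_nat phi) two rmorph0.
have Bxx x : B x x = phi u * x ^+ 2 + phi w.
  by rewrite /B -mulr2n -mulr_natr twoK !mulr0 addr0 expr2.
have [u0|u0] := eqVneq u 0.
  exists [::]; split=> // x; rewrite Bxx u0 rmorph0 mul0r add0r in_nil fmorph_eq0.
  apply/esym/negP => /eqP w0; have v0 := uv_neq0 u0.
  (* By the two identities below, u = w = 0 gives b1 v = b2 v = 0, hence b1 = b2 = 0. *)
  move: hb; rewrite -(mulIr_eq0 _ (mulIf v0)) -[b2 == 0](mulIr_eq0 _ (mulIf v0)).
  rewrite (_ : b1 * v = a1 * w + c1 * u); last by rewrite /u /v /w; ring.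
  rewrite (_ : b2 * v = a2 * w + c2 * u); last by rewrite /u /v /w; ring.
  by rewrite u0 w0 !mulr0 addr0 eqxx.
have [r] := quadratic_root 0 w u0; rewrite rmorph0 mul0r addr0 => Br.
have memr x : (x == r) = (B x x == 0).
  suff -> : B x x = phi u * (x - r) ^+ 2.
    by rewrite mulf_eq0 fmorph_eq0 (negbTE u0) sqrf_eq0 subr_eq0.
  rewrite Bxx -[LHS]subr0 -Br.
  rewrite (_ : _ - _ = phi u * ((x - r) ^+ 2 + 2 * (r * (x - r)))); last by ring.
  by rewrite twoK mul0r addr0.
exists [:: r]; split=> // x; rewrite inE // => /eqP ->; apply/eqP.
by rewrite memr; apply/eqP; apply: B_frob; apply/eqP; rewrite -memr.
Qed.

(** B(x, x) = u x^2 + 2 v x + w is separable, linear if u = 0. Frobenius permutes its roots, at most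
    two in number, so its square fixes them. *)
Lemma fixed_roots_odd : 2 != 0 :> F ->
  exists R : seq K, [/\ uniq R, size R = (u != 0).+1,
    forall x, (x \in R) = (B x x == 0) & forall x, x \in R -> fr 2 x = x].
Proof.
move=> two; have twoK : 2 != 0 :> K by rewrite -(rmorph_nat phi) fmorph_eq0.
pose p : {poly F} := u *: 'X^2 + (2 * v) *: 'X + w%:P.
have sp : size p = (u != 0).+2.
  have [u0|u0] := eqVneq u 0.
    have s1 : size ((2 * v) *: 'X) = 2.
      by rewrite size_scale ?size_polyX // mulf_neq0 // uv_neq0.
    by rewrite /p u0 scale0r add0r size_polyDl s1 // (leq_ltn_trans (size_polyC_leq1 _)).
  apply/eqP; rewrite eqn_leq size_quadratic ltnNge; apply: contra u0 => sp.
  by rewrite -(coef_quadratic u (2 * v) w) nth_default.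
have p0 : p != 0 by rewrite -size_poly_eq0 sp.
have sepp : separable_poly p.
  (* This is the discriminant identity 4 u p - p'^2 = 4 (u w - v^2). *)
  apply: (@separable_Bezout _ _ (4 * u)%:P (- p^`()) (4 * (u * w - v ^+ 2))).
    rewrite mulf_neq0 //; first by rewrite (natrM _ 2 2) mulf_neq0.
    by rewrite subr_eq0 eq_sym resultant_neq0.
  rewrite /p !(derivD, derivZ, derivXn, derivX, derivC) /= addr0 expr1.
  rewrite -!mul_polyC !(polyCB, polyCM, polyC_exp, polyC_natr).
  by ring.
have [||R [UR sR memR]] := @separable_roots _ p^i.
- by rewrite map_poly_eq0.
- by rewrite separable_map.
have memB x : (x \in R) = (B x x == 0).
  rewrite memR /root horner_quadratic rmorphM rmorph_nat; congr (_ == 0).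
  by rewrite /B; ring.
exists R; split=> // [|x xR]; first by rewrite sR size_map_poly sp.
have frR m : fr m x \in R by rewrite memB; apply/eqP/B_frob/eqP; rewrite -memB.
have nU : ~~ uniq [:: x; fr 1 x; fr 2 x].
  apply/negP => U; have sub : {subset [:: x; fr 1 x; fr 2 x] <= R}.
    by move=> y; rewrite !inE => /or3P[] /eqP ->.
  have := uniq_leq_size U sub; rewrite sR size_map_poly sp /=.
  by case: (u != 0).
have frS : fr 2 x = fr 1 (fr 1 x) by rewrite frob_comp.
apply: contraNeq nU => x2; rewrite /= !inE !andbT negb_or.
have x1 : x != fr 1 x.
  by apply: contraNneq x2 => x1; rewrite frS -!x1.
by rewrite x1 eq_sym x2 frS (inj_eq (fmorph_inj (fr 1))) x1.
Qed.

(** * Moebius inversion over the odd divisors *)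

Definition moved_roots m (s : seq K) := [seq x <- s | fr m x != x].

(** Where [fr m x = x], the two conditions coincide, so the roots dropped from [Z] are the members
    of [R] fixed by [fr m]. *)
Lemma size_moved_roots m Z R : uniq Z -> uniq R ->
  (forall x, (x \in Z) = (B x (fr m x) == 0)) ->
  (forall x, (x \in R) = (B x x == 0)) ->
  (size (moved_roots m Z) + count (fun x => fr m x == x) R = size Z)%N.
Proof.
move=> UZ UR memZ memR.
rewrite size_filter -[RHS](count_predC (fun x => fr m x == x)) addnC; congr (_ + _)%N.
rewrite -!size_filter; apply/perm_size/uniq_perm; rewrite ?filter_uniq // => x.
by rewrite !mem_filter memZ memR; case: eqP => //= ->.
Qed.

Lemma frob_odd_mul k d x : fr (2 * k) x = x -> odd d -> fr (d * k) x = fr k x.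
Proof.
move=> xk od; rewrite -[d]odd_double_half od mulnDl mul1n -frob_comp.
by rewrite -mul2n (mulnC 2%N) -mulnA frob_mul.
Qed.

Lemma frob_parity m x : fr 2 x = x -> fr m x = fr (odd m) x.
Proof.
by move=> x2; rewrite -{1}[m]odd_double_half -frob_comp -muln2 frob_mul.
Qed.

(** In [fr (odd n)], [odd n] is read as 0 or 1: [fr 2] fixes [R], so only the parity of the iterate
    matters, and n/d has the parity of [n] for odd [d]. The correction is thus the same for all
    [d]. *)
Lemma card_I_set_mobius n R : (1 < n)%N -> uniq R ->
  (forall x, (x \in R) = (B x x == 0)) -> (forall x, x \in R -> fr 2 x = x) ->
  (2 * n * #|I_set n g h|)%:R =
  \sum_(d <- divisors n | odd d) mobius d * (#|F| ^ (n %/ d))%:R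
  + ((u != 0)%:R - (count (fun x => fr (odd n) x == x) R)%:R)
    * (n == (2 ^ logn 2 n)%N)%:R.
Proof.
move=> n1 UR memR R2; have n0 := ltnW n1.
have [Z [UZ sZ memZ]] := cross_roots n0.
pose E := moved_roots n Z.
have UE : uniq E by rewrite filter_uniq.
have memE x : (x \in E) = (fr n x != x) && (B x (fr n x) == 0).
  by rewrite mem_filter memZ.
pose S := [seq x <- E | fdeg phi (2 * n) x].
have memS x : (x \in S) = fdeg phi (2 * n) x && (B x (fr n x) == 0).
  rewrite mem_filter memE; case: (boolP (fdeg _ _ _)) => //= xd.
  by rewrite (fdegE _ xd); case: (boolP (_ %| _)%N) => // /dvdn_leq; lia.
(* The indicator of powers of 2 is expanded back into a sum of mu(d), so that the two sides can be
   compared term by term. *)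
rewrite -(card_I_set n1 _ memS) ?filter_uniq // -sum_mobius_odd // mulr_sumr -big_split.
transitivity (\sum_(d <- divisors n | odd d)
    mobius d * (count (fun x => fr (2 * (n %/ d)) x == x) E)%:R).
  (* After the exchange of sums, a point of degree [D] contributes the sum of mu(d) over odd [d]
     with D | 2n/d. Since [D] divides 2n but not [n], this is [D = 2n]. *)
  under eq_bigr do rewrite natr_count mulr_sumr.
  rewrite exchange_big /= size_filter natr_count big_seq [RHS]big_seq.
  apply: eq_bigr => x; rewrite memE => /andP[xn /eqP Bx].
  have x2n := B_frob_period Bx.
  have [D _ xD] : exists2 D, (D <= 2 * n)%N & fdeg phi D x.
    by apply: fdeg_exists => //; rewrite muln_gt0.
  have Dn : (D %| 2 * n)%N by rewrite -(fdegE _ xD) x2n.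
  have nDn : ~~ (D %| n)%N by rewrite -(fdegE _ xD).
  under eq_bigr do rewrite (fdegE _ xD).
  rewrite sum_mobius_odd_dvd //; congr (nat_of_bool _)%:R.
  apply/idP/eqP => [x2|<- //]; apply/eqP; rewrite eqn_dvd Dn.
  by rewrite -(fdegE _ x2) (fdegE _ xD) dvdnn.
rewrite big_seq_cond [RHS]big_seq_cond; apply: eq_bigr => d /andP[].
rewrite -dvdn_divisors // => dn od.
case/dvdnP: dn => k nE; have d0 : (0 < d)%N by case: (d) od.
have k0 : (0 < k)%N by move: n0; rewrite nE muln_gt0 => /andP[].
have [Zk [UZk sZk memZk]] := cross_roots k0.
have /esym := size_moved_roots UZk UR memZk memR; rewrite sZk => sE.
have -> : (n %/ d)%N = k by rewrite nE mulnK.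
(* If [fr (2 * k)] fixes [x], then [fr n x = fr k x], because n = dk with [d] odd. *)
have -> : count (fun x => fr (2 * k) x == x) E = size (moved_roots k Zk).
  rewrite -size_filter; apply/perm_size/uniq_perm; rewrite ?filter_uniq // => x.
  rewrite !mem_filter memZ memZk; case: eqP => /= x2k.
    by rewrite nE mulnC frob_odd_mul.
  by apply/esym/negP => /andP[_ /eqP /B_frob_period].
have -> : count (fun x => fr (odd n) x == x) R = count (fun x => fr k x == x) R.
  apply: eq_in_count => x xR; rewrite (frob_parity k (R2 x xR)) nE oddM od andbT.
  by [].
rewrite [X in _ = _ + X]mulrC -mulrDr; congr (_ * _).
by rewrite addrA -natrD sE natrD addrK.
Qed.

Lemma I_set_inseparable n : (1 < n)%N -> 2 = 0 :> F -> b1 = 0 -> b2 = 0 ->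
  #|I_set n g h| = 0.
Proof.
move=> n1 two b10 b20; apply: eq_card0 => f; apply/negP => fI.
have [sf _ irrf _] := I_setP _ fI.
have [x rx] : exists x, root (quad_transform n g h f)^i x.
  by apply/closed_rootP; rewrite size_map_poly (size_qt irrf) //; lia.
have [xd] := I_set_root n1 fI rx.
have u0 : u = 0 by rewrite /u b10 b20 !mulr0 subr0.
have w0 : w = 0 by rewrite /w b10 b20 !mul0r subr0.
have twoK : 2 = 0 :> K by rewrite -(rmorph_nat phi) two rmorph0.
rewrite /B u0 w0 !rmorph0 mul0r add0r addr0 => /eqP.
rewrite mulf_eq0 fmorph_eq0 (negbTE (uv_neq0 u0)) /= => /eqP E.
have : fr n x == x.
  by apply/eqP/(addrI x); rewrite E -mulr2n -mulr_natr twoK mulr0.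
by rewrite (fdegE _ xd) => /dvdn_leq; lia.
Qed.

End QuadraticMap.

(** * Parity of q and the three cases *)

Lemma card_finField_even (F : finFieldType) : 2 = 0 :> F ->
  exists2 l, (0 < l)%N & #|F| = (2 ^ l)%N.
Proof.
move=> two; have p2 : 2%N \in [pchar F] by rewrite inE /= two eqxx.
have := card_pprimeChar p2; set l := (X in (2 ^ X)%N) => El.
by exists l => //; have := finRing_gt1 F; rewrite El; case: (l).
Qed.

Lemma odd_card_finField (F : finFieldType) : odd #|F| = (2 != 0 :> F).
Proof.
have [two|two] := eqVneq (2 : F) 0.
  by have [l l0 ->] := card_finField_even two; rewrite oddX; case: l l0.
have [p p_pr pF] := finPcharP F.
rewrite (card_pprimeChar pF) oddX; apply/orP; right.
case: (even_prime p_pr) => // p2; case/eqP: two.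
by have := pcharf0 pF; rewrite p2.
Qed.

Lemma sum_odd_divisors_pow2 (R : nmodType) m (f : nat -> R) :
  \sum_(d <- divisors (2 ^ m) | odd d) f d = f 1%N.
Proof.
have n0 : (0 < 2 ^ m)%N by rewrite expn_gt0.
rewrite -big_filter (perm_big [:: 1%N]) ?big_seq1 //.
apply: uniq_perm; rewrite ?filter_uniq ?divisors_uniq // => d.
rewrite mem_filter -dvdn_divisors // inE; apply/andP/eqP => [[od]|-> //].
move/(dvdn_pfactor _ _ (isT : prime 2)) => [k _ Ed].
by move: od; rewrite Ed oddX; case: k {Ed}.
Qed.

Theorem theorem2 (F : finFieldType) (q : nat) (hq : #|F| = q)
  (a1 b1 c1 a2 b2 c2 : F) (g h : {poly F})
  (hg : g = a1 *: 'X^2 + b1 *: 'X + c1%:P)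
  (hh : h = a2 *: 'X^2 + b2 *: 'X + c2%:P)
  (hcop : coprimep g h)
  (hdeg : maxn (size g).-1 (size h).-1 = 2%N)
  (n : nat) (hn : (1 < n)%N) :
  let case1 := b1 = 0 /\ b2 = 0 /\ (exists l : nat, (1 <= l)%N /\ q = (2 ^ l)%N) in
  let case2 := odd q /\ (exists m : nat, (1 <= m)%N /\ n = (2 ^ m)%N) in
  let N : rat := #|I_set n g h|%:R in
  (case1 -> N = 0) /\
  (case2 -> N = 1 / (2 * n)%N%:R * (q%:R ^+ n - 1)) /\
  (~ case1 -> ~ case2 ->
     N = 1 / (2 * n)%N%:R *
         \sum_(d <- divisors n | odd d) (mobius d)%:~R * q%:R ^+ (n %/ d)).
Proof.
have ha : (a1 != 0) || (a2 != 0).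
  have top (a b c : F) (p : {poly F}) : p = a *: 'X^2 + b *: 'X + c%:P ->
      (size p).-1 = 2%N -> a != 0.
    move=> Ep sp; rewrite -(coef_quadratic a b c) -Ep -sp.
    by rewrite lead_coef_eq0 -size_poly_eq0; case: (size p) sp.
  case: (leqP (size g).-1 (size h).-1) hdeg => _.
    by move/(top _ _ _ _ hh) ->; rewrite orbT.
  by move/(top _ _ _ _ hg) ->.
subst g h => case1 case2; set I := I_set _ _ _ => N.
have [K [phi _]] := countable_algebraic_closure F.
have n0 := ltnW hn.
have n20 : (2 * n)%N%:R != 0 :> rat by rewrite pnatr_eq0 muln_eq0 -lt0n.
have intr_nat k : (k%:R : int)%:~R = k%:R :> rat by rewrite natz -pmulrn.
have NE (T : int) : (2 * n * #|I|)%:R = T -> N = 1 / (2 * n)%N%:R * T%:~R.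
  by move=> <-; rewrite intr_nat (natrM _ (2 * n)) mul1r mulKf.
have sumE : (\sum_(d <- divisors n | odd d) mobius d * (#|F| ^ (n %/ d))%:R)%:~R
    = \sum_(d <- divisors n | odd d) (mobius d)%:~R * q%:R ^+ (n %/ d) :> rat.
  rewrite rmorph_sum; apply: eq_bigr => d _.
  by rewrite rmorphM /= intr_nat natrX hq.
have evenP : 2 = 0 :> F <-> ~~ odd q by rewrite -hq odd_card_finField negbK; split=> /eqP.
split=> [[b10 [b20 [l [l0 ql]]]]|].
  have two : 2 = 0 :> F by apply/evenP; rewrite ql oddX; case: l l0 {ql}.
  by rewrite /N /I (I_set_inseparable phi hcop ha hn two b10 b20).
split.
  case=> oq [m [m1 nE]].
  have two : 2 != 0 :> F by apply/eqP => /evenP; rewrite oq.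
  have [R [UR sR memR R2]] := fixed_roots_odd phi hcop ha two.
  have := card_I_set_mobius hcop ha hn UR memR R2.
  (* For even [n] the iterate is [fr 0], the identity, so all of [R] counts and the correction is
     [u <> 0] - ([u <> 0] + 1) = -1. *)
  have -> : odd n = false by rewrite nE oddX; case: m m1 {nE}.
  rewrite (eq_count (a2 := predT)) => [|x]; last by rewrite /= frob0 eqxx.
  move/NE ->; congr (_ * _); rewrite count_predT sR -addn1 natrD opprD addrA subrr add0r.
  rewrite nE sum_odd_divisors_pow2 pfactorK // eqxx mulr1 divn1 mul1r.
  by rewrite rmorphD /= intr_nat natrX hq.
move=> ncase1 ncase2.
have [two|two] := eqVneq (2 : F) 0.
  have hb : (b1 != 0) || (b2 != 0).
    rewrite -negb_and; apply/negP => /andP[/eqP b10 /eqP b20]; apply: ncase1.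
    by have [l l0 lE] := card_finField_even two; do 2!split=> //; exists l; rewrite -hq.
  have [R [UR sR memR R1]] := fixed_roots_char2 phi hcop ha two hb.
  have fixR m x : x \in R -> frob phi m x = x.
    by move=> xR; rewrite -[m]muln1 frob_mul // R1.
  have := card_I_set_mobius hcop ha hn UR memR (fixR 2).
  (* Every iterate fixes [R], which has [u <> 0] elements, so the correction is 0 for every [n]. *)
  rewrite (eq_in_count (a2 := predT)) => [|x xR]; last by rewrite /= fixR ?eqxx.
  by rewrite count_predT sR subrr mul0r addr0 => /NE ->; rewrite sumE.
have [R [UR sR memR R2]] := fixed_roots_odd phi hcop ha two.
have := card_I_set_mobius hcop ha hn UR memR R2.
(* With [q] odd, a power of 2 would fall under [case2]; for any other [n] the correction is
   multiplied by 0. *)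
case: (n =P (2 ^ logn 2 n)%N) => [nE|_]; last by rewrite mulr0 addr0 => /NE ->; rewrite sumE.
case: ncase2; split; first by rewrite -hq odd_card_finField.
exists (logn 2 n); split=> //.
by case: (logn 2 n) nE => // n1; move: hn; rewrite n1.
Qed.
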